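(* Let $G=(V,P,d)$ be a reversible metric Markov chain with non-negative Ollivier curvature, and let $W\subset V$. Then \[ |\partial W|\ge\frac{P_0}{\operatorname{diam}(\operatorname{cl}(W))}\,m(W)(1-m(W)). \]
   Context: $V$ finite; $P$ with symmetric support; $x\sim y$ iff $x\ne y$, $P(x,y)>0$; $d$ a finite path distance ($d(x,y)=\inf\sum d(x_{k-1},x_k)$ over paths $x=x_0\sim\dots\sim x_n=y$); $m$ the probability with $m(x)P(x,y)=m(y)P(y,x)$. $\Delta f(x)=\sum_yP(x,y)(f(y)-f(x))$; Ollivier curvature $\kappa(x,y)=\inf\{(\Delta f(x)-\Delta f(y))/d(x,y): f\ 1\text{-Lipschitz},\ f(y)-f(x)=d(x,y)\}\ge0$ for all $x\sim y$. $P_0=\inf_{x\sim y}P(x,y)d(x,y)^2$. $|\partial W|=\sum_{x\in W,y\notin W}P(x,y)m(x)d(x,y)$. $\operatorname{cl}(W)=W\cup\{x:x\sim y\text{ for some }y\in W\}$, and $\operatorname{diam}(S)=\max_{x,y\in S}d(x,y)$ measured in the distance $d$ of $G$. *)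

(* Defs.v *)
From HB Require Import structures.
From mathcomp Require Import all_boot all_order all_algebra.
From mathcomp Require Import classical_sets reals.
Set Implicit Arguments. Unset Strict Implicit. Unset Printing Implicit Defensive.
Import Order.TTheory GRing.Theory Num.Theory.
Local Open Scope ring_scope.
Local Open Scope classical_set_scope.

Section MarkovDefs.
Variables (R : realType) (V : finType).

Definition adj (P : V -> V -> R) : rel V := fun x y => (x != y) && (0 < P x y).

Definition markov_kernel (P : V -> V -> R) : Prop :=
  (forall x y, 0 <= P x y) /\ (forall x, \sum_(y : V) P x y = 1).

Definition symmetric_support (P : V -> V -> R) : Prop :=
  forall x y, (0 < P x y) = (0 < P y x).

Definition path_length (d : V -> V -> R) (x : V) (p : seq V) : R :=
  \sum_(e <- zip (x :: p) p) d e.1 e.2.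

Definition path_lengths (P : V -> V -> R) (d : V -> V -> R) (x y : V) : set R :=
  [set s | exists p : seq V, [/\ path (adj P) x p, last x p = y & s = path_length d x p]].

(* d is a finite path distance: positive off the diagonal, symmetric, every
   pair is joined by a path (finiteness) and
   d(x,y) = inf over paths x = x_0 ~ ... ~ x_n = y of sum d(x_{k-1},x_k). *)
Definition path_distance (P : V -> V -> R) (d : V -> V -> R) : Prop :=
  [/\ forall x y, x != y -> 0 < d x y,
      forall x y, d x y = d y x,
      forall x y, path_lengths P d x y !=set0
    & forall x y, d x y = inf (path_lengths P d x y)].

Definition reversible_prob (P : V -> V -> R) (m : V -> R) : Prop :=
  [/\ forall x, 0 <= m x, \sum_(x : V) m x = 1
    & forall x y, m x * P x y = m y * P y x].

Definition laplacian (P : V -> V -> R) (f : V -> R) (x : V) : R :=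
  \sum_(y : V) P x y * (f y - f x).

Definition lipschitz1 (d : V -> V -> R) (f : V -> R) : Prop :=
  forall u v, `|f u - f v| <= d u v.

Definition ollivier_curvature (P : V -> V -> R) (d : V -> V -> R) (x y : V) : R :=
  inf [set k | exists f : V -> R,
        [/\ lipschitz1 d f, f y - f x = d x y
          & k = (laplacian P f x - laplacian P f y) / d x y]].

Definition P0 (P : V -> V -> R) (d : V -> V -> R) : R :=
  inf [set r | exists x y, adj P x y /\ r = P x y * d x y ^+ 2].

Definition measure_of (m : V -> R) (W : {set V}) : R := \sum_(x in W) m x.

Definition boundary (P : V -> V -> R) (d : V -> V -> R) (m : V -> R) (W : {set V}) : R :=
  \sum_(x in W) \sum_(y in ~: W) P x y * m x * d x y.

Definition closure_set (P : V -> V -> R) (W : {set V}) : {set V} :=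
  W :|: [set x | [exists y in W, adj P x y]].

Definition diam (d : V -> V -> R) (S : {set V}) : R :=
  \big[Num.max/0]_(x in S) \big[Num.max/0]_(y in S) d x y.

End MarkovDefs.

(* Main.v *)
Require Import Defs.
From HB Require Import structures.
From mathcomp Require Import all_boot all_order all_algebra.
From mathcomp Require Import classical_sets reals.
From mathcomp Require Import ring lra.
Import Order.TTheory GRing.Theory Num.Theory.
Local Open Scope ring_scope.
Set Implicit Arguments.
Unset Strict Implicit.

(* Put K = V \ W. Up to an arbitrarily small error there are a constant C and a
   1-Lipschitz f with Lap f = C on K and f x = max_(y in K) (f y - d x y) on W:
   we solve Lap f = mu f on K by Perron's method and let mu tend to 0, so that
   mu f, which oscillates by at most mu times the total distance, becomes
   constant. Each x in W then starts an edge along which f increases at full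
   speed; by non-negative curvature Lap f decreases along such edges, whence
   Lap f >= C on W. Green's formula for f gives |dW| >= - C m(K). Green's formula
   for (f - min f)^2 / (2 D) on cl(W), whose slope lies in [0, 1], gives
   |dW| >= (min(C, 0) + P0 / D) m(W): the increasing edges inside W contribute
   P0 / (2 D) at both endpoints, and those leaving W contribute the second half
   because the square has slope at most 1 - d(x,y) / (2 D) along them. The
   average of the two bounds with weights m(W) and m(K) is the theorem. *)

(** * Path distances and Lipschitz functions *)

Section PathDistance.
Variables (R : realType) (V : finType) (P d : V -> V -> R).
Hypothesis hd : path_distance P d.

Lemma dist_gt0 x y : x != y -> 0 < d x y.
Proof. by case: hd => h _ _ _; exact: h. Qed.

Lemma distC x y : d x y = d y x.
Proof. by case: hd. Qed.

Lemma path_length_cons x z (p : seq V) :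
  path_length d x (z :: p) = d x z + path_length d z p.
Proof. by rewrite /path_length /= big_cons. Qed.

Lemma path_length_ge0 x (p : seq V) : path (adj P) x p -> 0 <= path_length d x p.
Proof.
elim: p x => [|z p IH] x /=; first by rewrite /path_length big_nil.
move=> /andP[/andP[xz _] pz]; rewrite path_length_cons.
by rewrite addr_ge0 ?IH// ltW// dist_gt0.
Qed.

Lemma path_lengths_lbound0 x y : lbound (path_lengths P d x y) 0.
Proof. by move=> _ [p [pp _ ->]]; exact: path_length_ge0. Qed.

Lemma dist_le_path_length x (p : seq V) :
  path (adj P) x p -> d x (last x p) <= path_length d x p.
Proof.
move=> pp; case: hd => _ _ _ ->; apply: ge_inf; last by exists p.
by exists 0; exact: path_lengths_lbound0.
Qed.

Lemma dist_glb x y (c : R) :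
  (forall p, path (adj P) x p -> last x p = y -> c <= path_length d x p) ->
  c <= d x y.
Proof.
case: hd => _ _ ne E h; rewrite E; apply: lb_le_inf; first exact: ne.
by move=> _ [p [pp lp ->]]; exact: h.
Qed.

Lemma dist_ge0 x y : 0 <= d x y.
Proof. by apply: dist_glb => p pp _; exact: path_length_ge0. Qed.

Lemma distxx x : d x x = 0.
Proof.
apply/eqP; rewrite eq_le dist_ge0 andbT.
by have := @dist_le_path_length x [::] isT; rewrite /path_length big_nil.
Qed.

Lemma lipschitz1_adj (f : V -> R) :
  (forall u v, adj P u v -> `|f u - f v| <= d u v) -> lipschitz1 d f.
Proof.
move=> h u v; apply: dist_glb => p; elim: p u => [|z p IH] u /=.
  by move=> _ ->; rewrite subrr normr0 /path_length big_nil.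
move=> /andP[uz pz] lz; rewrite path_length_cons.
by rewrite (le_trans (ler_distD (f z) _ _))// lerD ?h ?IH.
Qed.

Lemma dist_triangle y x z : d x z <= d x y + d y z.
Proof.
have adj_tri u v w : adj P u v -> d u w <= d u v + d v w.
  move=> uv; rewrite -lerBlDl; apply: dist_glb => p pp lp.
  rewrite lerBlDl -path_length_cons -lp.
  by apply: (@dist_le_path_length u (v :: p)); rewrite /= uv.
rewrite -lerBlDr; apply: dist_glb => p; elim: p x => [|w p IH] x /=.
  by move=> _ ->; rewrite subrr /path_length big_nil.
move=> /andP[xw pw] lw; rewrite path_length_cons.
have := adj_tri _ _ z xw; have := IH _ pw lw; lra.
Qed.

(** There are finitely many first steps out of [x], so some neighbor minimizes [d x z + d z y];
    every path to [y] is at least that long. No shortest path has to be built. *)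
Lemma exists_next_vertex x y : x != y ->
  exists2 z, adj P x z & d x z + d z y = d x y.
Proof.
move=> xy; have [_ _ /(_ x y)[_ [[|z0 p] [/= pp lp _]]] _] := hd.
  by rewrite lp eqxx in xy.
have /andP[az0 _] := pp.
have [z az zmin] := arg_minP (fun z => d x z + d z y) az0.
exists z => //; apply/eqP; rewrite eq_le dist_triangle andbT.
apply: dist_glb => -[|w q] /=; first by move=> _ E; rewrite E eqxx in xy.
move=> /andP[aw qw] lq; rewrite path_length_cons.
apply: (le_trans (zmin _ aw)); rewrite lerD2l -lq.
exact: dist_le_path_length.
Qed.

Lemma dist_le_diam (S : {set V}) x y : x \in S -> y \in S -> d x y <= diam d S.
Proof.
move=> xS yS; rewrite /diam; apply: le_trans (le_bigmax_cond _ _ xS).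
exact: (le_bigmax_cond _ (fun y => d x y) yS).
Qed.

End PathDistance.

(** * Bounds on the Laplacian and its monotonicity along tight edges *)

Section Laplacian.
Variables (R : realType) (V : finType) (P d : V -> V -> R).
Hypotheses (hP : markov_kernel P) (hd : path_distance P d).

Definition total_dist : R := \sum_(x : V) \sum_(y : V) d x y.

Lemma dist_le_total x y : d x y <= total_dist.
Proof.
rewrite /total_dist (bigD1 x)//= (bigD1 y)//= -addrA lerDl addr_ge0//.
  by apply: sumr_ge0 => z _; exact: (dist_ge0 hd).
by apply: sumr_ge0 => u _; apply: sumr_ge0 => z _; exact: (dist_ge0 hd).
Qed.

Lemma laplacianE (f : V -> R) x : laplacian P f x = \sum_y P x y * f y - f x.
Proof.
case: hP => _ P1; rewrite /laplacian.
under eq_bigr do rewrite mulrBr.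
by rewrite sumrB -mulr_suml P1 mul1r.
Qed.

Lemma laplacian_bound (f : V -> R) x :
  lipschitz1 d f -> `|laplacian P f x| <= total_dist.
Proof.
move=> lf; case: hP => P0 P1; apply: (le_trans (ler_norm_sum _ _ _)).
rewrite -[leRHS]mul1r -(P1 x) mulr_suml; apply: ler_sum => y _.
rewrite normrM ger0_norm//; apply: ler_wpM2l => //.
exact: (le_trans (lf _ _) (dist_le_total _ _)).
Qed.

Lemma curvature_ge0_laplacian (f : V -> R) x y :
  adj P x y -> 0 <= ollivier_curvature P d x y ->
  lipschitz1 d f -> f y - f x = d x y -> laplacian P f y <= laplacian P f x.
Proof.
move=> /andP[xy _] hk lf fxy; rewrite -subr_ge0.
have dxy := dist_gt0 hd xy.
rewrite -(pmulr_lge0 _ (_ : 0 < (d x y)^-1)) ?invr_gt0//.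
apply: (le_trans hk); apply: ge_inf; last by exists f.
(* [inf] is a lower bound only of a set bounded below; the crude bound on the Laplacian supplies
   one. *)
exists (- (2 * total_dist / d x y)) => _ [g [lg _ ->]].
rewrite -mulNr ler_pM2r ?invr_gt0//.
have := laplacian_bound x lg; have := laplacian_bound y lg.
rewrite !ler_norml; lra.
Qed.

End Laplacian.

(** * The extremal function: flow step, extension from [K], Perron's method *)

Section Separation.
Variables (R : realType) (V : finType) (P d : V -> V -> R).
Hypotheses (hP : markov_kernel P) (hsym : symmetric_support P).
Hypothesis hd : path_distance P d.
Hypothesis hcurv : forall x y, adj P x y -> 0 <= ollivier_curvature P d x y.

(** An Euler step of the flow f' = Lap f - mu f. Pairs with slack absorb a small step; along a tight
    edge, curvature makes Lap f - mu f decrease, so the increment does not grow. The bound on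
    [e * (1 + mu)] keeps the step a subsolution later. *)
Lemma lipschitz1_flow (f : V -> R) (mu : R) : 0 <= mu -> lipschitz1 d f ->
  exists2 e, 0 < e /\ e * (1 + mu) <= 1 &
    lipschitz1 d (fun x => f x + e * (laplacian P f x - mu * f x)).
Proof.
move=> mu0 lf; pose G x := laplacian P f x - mu * f x.
pose slack (p : V * V) := d p.1 p.2 - (f p.2 - f p.1).
pose step p := slack p / (`|G p.2 - G p.1| + 1).
pose e := \big[Num.min/(1 + mu)^-1]_(p | 0 < slack p) step p.
have mu1 : 0 < 1 + mu by lra.
have e0 : 0 < e.
  apply: lt_bigmin; first by rewrite invr_gt0.
  by move=> p sp; rewrite divr_gt0// ltr_wpDl.
have emu : e * (1 + mu) <= 1.
  by rewrite -ler_pdivlMr// mul1r; exact: bigmin_le_id.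
exists e => //.
have flow_le u v : adj P u v -> f v + e * G v - (f u + e * G u) <= d u v.
  move=> uv; have sge0 : 0 <= slack (u, v).
    by rewrite subr_ge0 (distC hd) (le_trans (ler_norm _)).
  have [tight|] := eqVneq (slack (u, v)) 0.
    have fuv : f v - f u = d u v by move: tight; rewrite /slack /=; lra.
    have lap := curvature_ge0_laplacian hP hd uv (hcurv uv) lf fuv.
    have : 0 <= e * (G u - G v).
      apply: mulr_ge0; first exact: ltW.
      have : 0 <= mu * (f v - f u) by rewrite fuv mulr_ge0// (dist_ge0 hd).
      rewrite /G; lra.
    lra.
  move=> sn0; have sp : 0 < slack (u, v) by rewrite lt_def sn0.
  have : e <= step (u, v) by exact: bigmin_le_cond.
  rewrite /step ler_pdivlMr ?ltr_wpDl//= => he.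
  have : e * (G v - G u) <= e * (`|G v - G u| + 1).
    apply: ler_wpM2l; first exact: ltW.
    by rewrite (le_trans (ler_norm _))// lerDl.
  move: he; rewrite /slack /=; lra.
apply: (lipschitz1_adj hd) => u v uv; rewrite ler_norml.
have vu : adj P v u by case/andP: uv; rewrite /adj eq_sym hsym => -> ->.
have := flow_le _ _ uv; have := flow_le _ _ vu; rewrite (distC hd v u) /G.
by move=> h1 h2; apply/andP; split; lra.
Qed.

(** McShane's smallest extension. A maximum of downward cones is 1-Lipschitz for any [F]; agreement
    on [K] uses that [F] is. *)
Lemma min_lipschitz_extension (F : V -> R) (K : {set V}) (y0 : V) : y0 \in K ->
  exists G : V -> R, [/\ forall x, exists2 y, y \in K & G x = F y - d x y,
    forall x y, y \in K -> F y - d x y <= G x,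
    lipschitz1 d G
  & lipschitz1 d F -> forall y, y \in K -> G y = F y].
Proof.
move=> y0K; pose G x := F [arg max_(y > y0 in K) (F y - d x y)]%O
                       - d x [arg max_(y > y0 in K) (F y - d x y)]%O.
have Gex x : exists2 y, y \in K & G x = F y - d x y.
  by rewrite /G; case: arg_maxP => // y yK _; exists y.
have Gge x y : y \in K -> F y - d x y <= G x.
  by move=> yK; rewrite /G; case: arg_maxP => // z zK; exact.
have Gle u v : G u - G v <= d u v.
  have [y yK ->] := Gex u; have := Gge v y yK.
  have := dist_triangle hd u v y; rewrite (distC hd v u); lra.
exists G; split => //.
  move=> u v; rewrite ler_norml Gle andbT lerNl opprB (distC hd); exact: Gle.
move=> lF y yK; apply/eqP; rewrite eq_le; apply/andP; split.
  have [z zK ->] := Gex y; rewrite lerBlDr -lerBlDl (distC hd).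
  exact: le_trans (ler_norm _) (lF _ _).
by have := Gge y y yK; rewrite (distxx hd) subr0.
Qed.

(** With the Lipschitz bound, the second clause makes [f] the smallest extension of its values on
    [K]; as an inequality it passes to suprema. *)
Definition subsolution (K : {set V}) (mu : R) (f : V -> R) : Prop :=
  [/\ lipschitz1 d f,
      forall x, exists2 y, y \in K & f x <= f y - d x y
    & forall y, y \in K -> mu * f y <= laplacian P f y].

(** Maximum principle: the second clause moves a global maximum into [K], where the Laplacian is
    then nonpositive. *)
Lemma subsolution_le0 (K : {set V}) (mu : R) f x : 0 < mu -> subsolution K mu f -> f x <= 0.
Proof.
move=> mu0 [_ fK fmu].
have [z _ zmax] := arg_maxP f (isT : xpredT x).
apply: (le_trans (zmax _ isT)); have [y yK fzy] := fK z.
apply: (le_trans fzy); apply: (@le_trans _ _ (f y)).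
  by rewrite lerBlDr lerDl (dist_ge0 hd).
have : mu * f y <= 0.
  apply: (le_trans (fmu _ yK)); apply: sumr_le0 => w _.
  case: hP => P0 _; apply: mulr_ge0_le0 => //; rewrite subr_le0.
  apply: (le_trans (zmax w isT)); apply: (le_trans fzy).
  by rewrite lerBlDr lerDl (dist_ge0 hd).
by rewrite pmulr_rle0.
Qed.

Lemma subsolution_exists (K : {set V}) (mu : R) y0 : 0 < mu -> y0 \in K ->
  exists f, subsolution K mu f.
Proof.
move=> mu0 y0K; pose M := total_dist d / mu.
have [G [Gex Gge lG GF]] := min_lipschitz_extension (fun=> - M) y0K.
have {}GF : forall y, y \in K -> G y = - M.
  by apply: GF => u v; rewrite subrr normr0 (dist_ge0 hd).
exists G; split => //.
  (* The value - [M] on [K] is so low that [mu] times it is below the Laplacian of any 1-Lipschitz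
     function. *)
  by move=> x; have [y yK ->] := Gex x; exists y => //; rewrite GF.
move=> y yK; rewrite GF// mulrN /M mulrCA divff ?gt_eqF// mulr1.
have := laplacian_bound hP hd y lG; by rewrite ler_norml => /andP[].
Qed.

(* Perron's method: the supremum of the subsolutions is a subsolution, and it
   solves the equation on [K] because the flow step of [lipschitz1_flow],
   re-extended from [K], is again a subsolution and does not lie below it. *)
Lemma resolvent_extension (K : {set V}) (mu : R) y0 : 0 < mu -> y0 \in K ->
  exists f, [/\ lipschitz1 d f,
    forall x, exists2 y, y \in K & f y - f x = d x y
  & forall y, y \in K -> laplacian P f y = mu * f y].
Proof.
move=> mu0 y0K; have [P0 P1] := hP.
pose E x := [set r | exists2 g, subsolution K mu g & r = g x]%classic.
pose f x := sup (E x).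
have Ene x : (E x !=set0)%classic.
  by have [g sg] := subsolution_exists mu0 y0K; exists (g x); exists g.
have fub g x : subsolution K mu g -> g x <= f x.
  move=> sg; apply: ub_le_sup; last by exists g.
  by exists 0 => _ [h sh ->]; exact: subsolution_le0 sh.
have flub x c : (forall g, subsolution K mu g -> g x <= c) -> f x <= c.
  by move=> h; apply: ge_sup => // _ [g sg ->]; exact: h.
have fle u v : f u - f v <= d u v.
  rewrite lerBlDr; apply: flub => g sg; have := fub g v sg.
  by case: sg => /(_ u v)/(le_trans (ler_norm _)) + _ _; lra.
have lf : lipschitz1 d f.
  by move=> u v; rewrite ler_norml fle andbT lerNl opprB (distC hd) fle.
have fK x : exists2 y, y \in K & f x <= f y - d x y.
  have [G [Gex Gge _ _]] := min_lipschitz_extension f y0K.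
  have [y yK Gy] := Gex x; exists y => //; rewrite -Gy.
  apply: flub => g sg; have [_ /(_ x)[z zK gz] _] := sg.
  by apply: (le_trans gz); apply: le_trans (Gge x z zK); rewrite lerB// fub.
(* Written as (1 + mu) f y <= sum of P y z * f z, both sides are monotone in f, so the inequality
   survives the supremum. *)
have fmu y : y \in K -> mu * f y <= laplacian P f y.
  move=> yK; rewrite laplacianE// lerBrDr -[X in _ + X]mul1r -mulrDl.
  rewrite mulrC -ler_pdivlMr ?addr_gt0//; apply: flub => g sg.
  rewrite ler_pdivlMr ?addr_gt0// mulrC mulrDl mul1r -lerBrDr.
  have [_ _ /(_ y yK)] := sg; rewrite laplacianE// => /le_trans; apply.
  by rewrite lerB// ler_sum// => z _; rewrite ler_wpM2l// fub.
have [e [e0 emu] lF] := lipschitz1_flow (ltW mu0) lf.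
set F := (fun x => _) in lF.
have [G [Gex Gge lG /(_ lF) GF]] := min_lipschitz_extension F y0K.
have fG x : f x <= G x.
  have [y yK fy] := fK x; apply: (le_trans fy); apply: le_trans (Gge x y yK).
  by rewrite lerB// /F lerDl mulr_ge0 ?(ltW e0)// subr_ge0 fmu.
have sG : subsolution K mu G.
  split => //; first by move=> x; have [y yK ->] := Gex x; exists y => //; rewrite GF.
  (* As G >= f everywhere and G y = f y + e v, the defect of [G] at [y] is at least (1 - e (1 + mu))
     v >= 0. *)
  move=> y yK; set v := laplacian P f y - mu * f y.
  have v0 : 0 <= v by rewrite subr_ge0 fmu.
  have GyE : G y = f y + e * v by rewrite GF.
  have : \sum_z P y z * f z <= \sum_z P y z * G z.
    by apply: ler_sum => z _; rewrite ler_wpM2l.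
  have : e * (1 + mu) * v <= 1 * v by rewrite ler_wpM2r.
  have : v = \sum_z P y z * f z - f y - mu * f y by rewrite /v laplacianE.
  rewrite laplacianE// GyE; move: (\sum_z _) (\sum_z _) => A B; nra.
exists f; split => //.
  move=> x; have [y yK fy] := fK x; exists y => //.
  by have := fle y x; rewrite (distC hd); move: fy; lra.
(* The subsolution [G] lies below the supremum [f], so the increment of the flow step on [K] is
   nonpositive. *)
move=> y yK; apply/eqP; rewrite eq_le fmu// andbT -subr_le0.
have := fub _ y sG; rewrite GF// /F gerDl pmulr_rle0//.
Qed.

Lemma increasing_neighbor (f : V -> R) x y : lipschitz1 d f -> x != y ->
  f y - f x = d x y -> exists2 z, adj P x z & f z - f x = d x z.
Proof.
move=> lf xy fxy; have [z xz dz] := exists_next_vertex hd xy; exists z => //.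
have := le_trans (ler_norm _) (lf y z); have := le_trans (ler_norm _) (lf z x).
rewrite (distC hd y z) (distC hd z x); lra.
Qed.

(** Off [K], climb a tight edge: the Laplacian does not increase and fewer vertices lie above, so
    the climb ends in [K]. *)
Lemma laplacian_ge_of_increasing (f : V -> R) (K : {set V}) (c : R) :
  lipschitz1 d f ->
  (forall x, exists2 y, y \in K & f y - f x = d x y) ->
  (forall y, y \in K -> c <= laplacian P f y) ->
  forall x, c <= laplacian P f x.
Proof.
move=> lf fK cK x.
have [n] := ubnP #|[set v | f x < f v]|; elim: n x => // n IH x.
rewrite ltnS => hn; have [xK|xK] := boolP (x \in K); first exact: cK.
have [y yK fy] := fK x.
have xy : x != y by apply: contraNneq xK => ->.
have [z xz fz] := increasing_neighbor lf xy fy.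
apply: le_trans (curvature_ge0_laplacian hP hd xz (hcurv xz) lf fz).
have fxz : f x < f z by rewrite -subr_gt0 fz (dist_gt0 hd)//; case/andP: xz.
apply: IH; apply: leq_trans hn; apply: proper_card; apply/properP; split.
  by apply/fintype.subsetP => v; rewrite !inE; exact: lt_trans.
by exists z; rewrite !inE ?ltxx.
Qed.

End Separation.

(** * Green's formula and the boundary estimates *)

Section Isoperimetry.
Variables (R : realType) (V : finType) (P d : V -> V -> R) (m : V -> R).
Hypotheses (hP : markov_kernel P) (hsym : symmetric_support P).
Hypotheses (hd : path_distance P d) (hm : reversible_prob P m).
Implicit Types (W : {set V}) (f h : V -> R).

Lemma flow_ge0 x y : 0 <= m x * P x y.
Proof. by case: hm => m0 _ _; case: hP => P0 _; rewrite mulr_ge0. Qed.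

Lemma flowC x y : m x * P x y = m y * P y x.
Proof. by case: hm. Qed.

Lemma boundary_ge0 W : 0 <= boundary P d m W.
Proof.
apply: sumr_ge0 => x _; apply: sumr_ge0 => y _.
by rewrite [P x y * _]mulrC mulr_ge0 ?flow_ge0 ?(dist_ge0 hd).
Qed.

Lemma sum_laplacian f W :
  \sum_(x in W) m x * laplacian P f x =
  \sum_(x in W) \sum_z m x * P x z * (f z - f x).
Proof.
apply: eq_bigr => x _; rewrite /laplacian mulr_sumr.
by apply: eq_bigr => z _; rewrite mulrA.
Qed.

Lemma sum_split_setC W (F : V -> V -> R) :
  \sum_(x in W) \sum_z F x z =
  \sum_(x in W) \sum_(z in W) F x z + \sum_(x in W) \sum_(z in ~: W) F x z.
Proof.
rewrite -big_split; apply: eq_bigr => x _ /=.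
by rewrite (bigID (mem W)) /=; congr (_ + _); apply: eq_bigl => z; rewrite inE.
Qed.

(** By reversibility the summand is antisymmetric, so the edges inside [W] cancel. *)
Lemma green f W :
  \sum_(x in W) m x * laplacian P f x =
  \sum_(x in W) \sum_(z in ~: W) m x * P x z * (f z - f x).
Proof.
rewrite sum_laplacian sum_split_setC -[RHS]add0r; congr (_ + _).
have E : \sum_(x in W) \sum_(z in W) m x * P x z * (f z - f x) =
         - \sum_(x in W) \sum_(z in W) m x * P x z * (f z - f x).
  rewrite [LHS]exchange_big /= -sumrN; apply: eq_bigr => x _.
  rewrite -sumrN; apply: eq_bigr => z _; rewrite flowC; ring.
lra.
Qed.

Lemma sum_laplacian_le_boundary f W : lipschitz1 d f ->
  \sum_(x in W) m x * laplacian P f x <= boundary P d m W.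
Proof.
move=> lf; rewrite green; apply: ler_sum => x _; apply: ler_sum => z _.
rewrite [P x z * m x]mulrC ler_wpM2l ?flow_ge0// (distC hd).
exact: le_trans (ler_norm _) (lf _ _).
Qed.

Lemma sum_laplacian_setC f W :
  \sum_(x in W) m x * laplacian P f x =
  - \sum_(x in ~: W) m x * laplacian P f x.
Proof.
rewrite !green finset.setCK -sumrN exchange_big; apply: eq_bigr => x _ /=.
rewrite -sumrN; apply: eq_bigr => z _; rewrite flowC; ring.
Qed.

Lemma P0_le x y : adj P x y -> P0 P d <= P x y * d x y ^+ 2.
Proof.
move=> xy; apply: ge_inf; last by exists x, y.
exists 0 => _ [u [v [_ ->]]]; rewrite mulr_ge0 ?sqr_ge0//.
by case: hP.
Qed.

Lemma P0_ge0 x y : adj P x y -> 0 <= P0 P d.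
Proof.
move=> xy; apply: lb_le_inf; first by exists (P x y * d x y ^+ 2), x, y.
by move=> _ [u [v [_ ->]]]; rewrite mulr_ge0 ?sqr_ge0//; case: hP.
Qed.

(* Every increasing edge is seen from both of its endpoints, except that an edge
   leaving [W] is seen from inside only; the term [d ^+ 2] makes up for this. *)
Lemma sum_sqr_increments W f : lipschitz1 d f ->
  (forall x, x \in W -> exists2 z, adj P x z & f z - f x = d x z) ->
  2 * P0 P d * measure_of m W <=
  \sum_(x in W) \sum_z m x * P x z * (f z - f x) ^+ 2 +
  \sum_(x in W) \sum_(z in ~: W) m x * P x z * d x z ^+ 2.
Proof.
move=> lf up; pose A x z := m x * P x z * Num.max (f z - f x) 0 ^+ 2.
have A0 x z : 0 <= A x z by rewrite mulr_ge0 ?flow_ge0 ?sqr_ge0.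
have AA x z : m x * P x z * (f z - f x) ^+ 2 = A x z + A z x.
  rewrite /A (flowC z x) -mulrDr; congr (_ * _).
  by case: (leP (f z - f x) 0); case: (leP (f x - f z) 0) => h1 h2; nra.
have low : P0 P d * measure_of m W <= \sum_(x in W) \sum_z A x z.
  rewrite /measure_of mulr_sumr; apply: ler_sum => x xW.
  have [z xz fz] := up x xW; rewrite (bigD1 z)//= -[leLHS]addr0.
  rewrite lerD ?sumr_ge0// /A fz (max_idPl (dist_ge0 hd _ _)) mulrC -mulrA.
  by rewrite ler_wpM2l ?P0_le//; case: hm.
rewrite -mulrA mulr_natl mulr2n; apply: (le_trans (lerD low low)).
rewrite !sum_split_setC addrACA -[leRHS]addrA; apply: lerD.
  rewrite [X in _ + X <= _]exchange_big -big_split /= ler_sum// => x _.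
  by rewrite -big_split /= ler_sum// => z _; rewrite AA.
rewrite -!big_split /= ler_sum// => x _.
rewrite -!big_split /= ler_sum// => z _.
rewrite AA -addrA lerD2l (le_trans (_ : _ <= m x * P x z * d x z ^+ 2))//.
  rewrite /A ler_wpM2l ?flow_ge0// ler_sqr ?nnegrE ?(dist_ge0 hd)//; last first.
    by rewrite le_max lexx orbT.
  rewrite ge_max (dist_ge0 hd) andbT (distC hd).
  exact: le_trans (ler_norm _) (lf _ _).
by rewrite lerDr.
Qed.

(* Apply Green's formula to the square of [f - min f]. *)
Lemma boundary_ge_convex W f c : lipschitz1 d f -> c <= 0 ->
  (forall x, x \in W -> c <= laplacian P f x) ->
  (forall x, x \in W -> exists2 z, adj P x z & f z - f x = d x z) ->
  (diam d (closure_set P W) * c + P0 P d) * measure_of m W <=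
  diam d (closure_set P W) * boundary P d m W.
Proof.
move=> lf c0 cW up; set D := diam d _.
have [->|/set0Pn[x0 x0W]] := eqVneq W finset.set0.
  by rewrite /measure_of /boundary !big_set0 !mulr0.
have x0cl : x0 \in closure_set P W by rewrite !inE x0W.
have [xa xacl amin] := arg_minP f x0cl.
pose u x := f x - f xa.
have u0 x : x \in closure_set P W -> 0 <= u x.
  by move=> xcl; rewrite subr_ge0; exact: amin.
have uD x : x \in closure_set P W -> u x <= D.
  move=> xcl; apply: le_trans (dist_le_diam d xcl xacl).
  exact: le_trans (ler_norm _) (lf _ _).
have sqr_lap x : m x * laplacian P (fun y => u y ^+ 2) x =
    m x * (2 * u x * laplacian P f x) + \sum_z m x * P x z * (f z - f x) ^+ 2.
  rewrite /laplacian !mulr_sumr -big_split /=; apply: eq_bigr => z _.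
  rewrite /u; ring.
have step1 : \sum_(x in W) m x * laplacian P (fun y => u y ^+ 2) x +
    \sum_(x in W) \sum_(z in ~: W) m x * P x z * d x z ^+ 2 <=
    2 * D * boundary P d m W.
  rewrite green /boundary mulr_sumr -big_split /= ler_sum// => x xW.
  rewrite mulr_sumr -big_split /= ler_sum// => z; rewrite inE => zW.
  rewrite -mulrDr [P x z * m x]mulrC.
  have [Pxz|Pxz] := ltP 0 (P x z); last first.
    have -> : P x z = 0 by apply/eqP; rewrite eq_le Pxz; case: hP => ->.
    by rewrite !(mulr0, mul0r).
  rewrite [leRHS]mulrCA ler_wpM2l ?flow_ge0//.
  have xz : x != z by apply: contraNneq zW => <-.
  have xcl : x \in closure_set P W by rewrite !inE xW.
  have zcl : z \in closure_set P W.
    rewrite !inE; apply/orP; right; apply/existsP; exists x.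
    by rewrite xW /adj eq_sym xz -hsym.
  have dD := dist_le_diam d xcl zcl; rewrite -/D in dD.
  have d0 := dist_ge0 hd x z.
  have uxz : u z - u x <= d x z.
    have := le_trans (ler_norm _) (lf z x); rewrite (distC hd z x) /u; lra.
  have := u0 _ xcl; have := u0 _ zcl; have := uD _ xcl; have := uD _ zcl.
  move: (u x) (u z) (d x z) uxz d0 dD => a b e *.
  (* The claim is b^2 - a^2 + e^2 <= 2 D e. If t = b - a > 0, then b^2 - a^2 <= t (2 D - t), which
     increases for t <= D, and t <= e <= D. *)
  have [ba|ab] := leP b a; nra.
have step2 : 2 * (D * c) * measure_of m W <=
    \sum_(x in W) m x * (2 * u x * laplacian P f x).
  rewrite /measure_of mulr_sumr ler_sum// => x xW; rewrite mulrC.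
  have xcl : x \in closure_set P W by rewrite !inE xW.
  rewrite ler_wpM2l//; first by case: hm.
  have := u0 _ xcl; have := uD _ xcl; have := cW _ xW.
  move: (u x) (laplacian P f x) => a l *.
  (* The sign of [c] is what turns [u x <= D] into a lower bound. *)
  have : a * c <= a * l by exact: ler_wpM2l.
  have : D * c <= a * c by exact: ler_wnM2r.
  lra.
have step3 := sum_sqr_increments lf up.
move: step1; under eq_bigr do rewrite sqr_lap; rewrite big_split /=.
by move: step2 step3; move: (\sum_(x in W) _) (\sum_(x in W) _) (\sum_(x in W) _) => *; lra.
Qed.

Lemma measure_of_ge0 W : 0 <= measure_of m W.
Proof. by apply: sumr_ge0 => x _; case: hm. Qed.

Lemma measure_of_setC W : measure_of m (~: W) = 1 - measure_of m W.
Proof.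
case: hm => _ m1 _; rewrite -m1 /measure_of [X in _ = X - _](bigID (mem W)) /=.
rewrite addrC addrK; by apply: eq_bigl => x; rewrite inE.
Qed.

End Isoperimetry.

(** * Combination of the two bounds *)

Unset Implicit Arguments.
Set Strict Implicit.

Theorem theorem6p8 (R : realType) (V : finType)
  (P : V -> V -> R) (d : V -> V -> R) (m : V -> R)
  (hP : markov_kernel P) (hsym : symmetric_support P)
  (hd : path_distance P d) (hm : reversible_prob P m)
  (hcurv : forall x y : V, adj P x y -> 0 <= ollivier_curvature P d x y)
  (W : {set V}) :
  boundary P d m W >=
    P0 P d / diam d (closure_set P W) * measure_of m W * (1 - measure_of m W).
Proof.
have [->|/set0Pn[x0 x0W]] := eqVneq W finset.set0.
  by rewrite /measure_of /boundary !big_set0 mulr0 mul0r.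
have := measure_of_setC hm W; have [E|/set0Pn[y0 y0K]] := eqVneq (~: W) finset.set0.
  rewrite E /measure_of big_set0 => <-.
  by rewrite mulr0; exact: boundary_ge0 hP hd hm W.
set K := ~: W in y0K *; set D := diam d _; move=> mK.
have x0y0 : x0 != y0 by apply: contraTneq y0K => <-; rewrite inE x0W.
have [z0 x0z0 _] := exists_next_vertex hd x0y0.
have P00 := P0_ge0 d hP x0z0.
have D0 : 0 < D.
  have x0cl : x0 \in closure_set P W by rewrite !inE x0W.
  have z0cl : z0 \in closure_set P W.
    rewrite !inE; apply/orP; right; apply/existsP; exists x0.
    by rewrite x0W /=; case/andP: x0z0; rewrite /adj eq_sym -hsym => -> ->.
  apply: lt_le_trans (dist_le_diam d x0cl z0cl).
  by apply: (dist_gt0 hd); case/andP: x0z0.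
have T0 : 0 <= total_dist d by exact: le_trans (dist_ge0 hd x0 y0) (dist_le_total hd _ _).
apply/ler_addgt0Pr => e e0.
(* Makes the oscillation of [mu * f] at most e / 2; the + 1 keeps the denominator positive. *)
pose mu := e / (2 * (total_dist d + 1)).
have mu0 : 0 < mu by rewrite divr_gt0//; lra.
have [f [lf fK fmu]] := resolvent_extension hP hsym hd hcurv mu0 y0K.
have muT : mu * total_dist d <= e / 2.
  have : mu * (2 * (total_dist d + 1)) = e by rewrite /mu divfK// gt_eqF//; lra.
  lra.
have near y : `|mu * f y - mu * f y0| <= e / 2.
  rewrite -mulrBr normrM gtr0_norm//; apply: le_trans muT.
  rewrite ler_wpM2l ?(ltW mu0)//.
  exact: le_trans (lf _ _) (dist_le_total hd _ _).
set C := mu * f y0 in near.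
have lowK y : y \in K -> C - e / 2 <= laplacian P f y.
  by move=> yK; rewrite fmu//; have := near y; rewrite ler_norml => /andP[]; lra.
have low := laplacian_ge_of_increasing hP hd hcurv lf fK lowK.
have up x : x \in W -> exists2 z, adj P x z & f z - f x = d x z.
  move=> xW; have [y yK fy] := fK x; apply: increasing_neighbor hd _ _ _ lf _ fy.
  by apply: contraTneq yK => <-; rewrite inE xW.
have W0 := measure_of_ge0 hm W; have K0 := measure_of_ge0 hm K.
set c := Num.min (C - e / 2) 0.
have c0 : c <= 0 by rewrite ge_min lexx orbT.
have boundW : (c + P0 P d / D) * measure_of m W <= boundary P d m W.
  rewrite -(ler_pM2l D0) mulrA mulrDr [D * (_ / D)]mulrC divfK ?gt_eqF//.
  apply: boundary_ge_convex => // x _.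
  by apply: le_trans (low x); rewrite ge_min lexx.
have boundK : - (C + e / 2) * measure_of m K <= boundary P d m W.
  apply: le_trans (sum_laplacian_le_boundary hP hd hm W lf).
  rewrite (sum_laplacian_setC hm) mulNr lerN2 /measure_of mulr_sumr ler_sum//.
  move=> y yK; rewrite mulrC ler_wpM2r ?fmu//; first by case: hm.
  by have := near y; rewrite ler_norml => /andP[]; lra.
have PD0 : 0 <= P0 P d / D by rewrite divr_ge0// ltW.
rewrite -mK; have W1 : measure_of m W = 1 - measure_of m K by rewrite mK; lra.
move: boundW boundK; rewrite /c minElt.
move: (boundary _ _ _ _) (P0 P d / D) PD0 (measure_of m K) (measure_of m W) W1 K0 W0.
move=> b g g0 k w wE k0 w0; case: ifP => [Cneg|Cnneg] bw bk.
  (* In the weighted average [C] cancels and the error is e k w <= e. *)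
  have h1 : k * ((C - e / 2 + g) * w) <= k * b by exact: ler_wpM2l.
  have h2 : w * (- (C + e / 2) * k) <= w * b by exact: ler_wpM2l.
  have -> : b = k * b + w * b by rewrite wE; ring.
  have : e * (k * w) <= e * 1.
    by rewrite ler_wpM2l ?(ltW e0)//; nra.
  lra.
(* Here the minimum is 0, and the bound from [W] alone suffices since k <= 1. *)
have : g * w * k <= g * w * 1 by rewrite ler_wpM2l ?mulr_ge0//; lra.
lra.
Qed.
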